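(* Let $w \in \mathrm{Br}_3$ be a positive braid whose braid closure $\widehat{w}$ is a knot and which gives a pseudo-Anosov map of the thrice-punctured disc. Then the set $R_w$ intersects the real axis in exactly two points: the point $1$ and a point in the half-open interval $\big(-1, (\sqrt{5}-3)/2\big]$.
   Context: $\mathrm{Br}_3 = \langle \sigma_1, \sigma_2 \mid \sigma_1\sigma_2\sigma_1 = \sigma_2\sigma_1\sigma_2\rangle$ is the 3-strand braid group; $w$ is positive if it is a product of positive powers of $\sigma_1,\sigma_2$. The reduced Burau representation $B_t : \mathrm{Br}_3 \to \mathrm{GL}_2(\mathbb{Z}[t^{\pm1}])$ is given by $B_t(\sigma_1) = \begin{pmatrix} -t & 1\\ 0 & 1\end{pmatrix}$, $B_t(\sigma_2) = \begin{pmatrix} 1 & 0 \\ t & -t\end{pmatrix}$. For a positive braid $w$, the entries of $B_t(w)$ are polynomials in $t$, and for $t \in \mathbb{C}$, $\rho_w(t)$ denotes the spectral radius (largest absolute value of an eigenvalue) of the complex matrix $B_t(w)$. Put $\overline{\mathbb{D}} = \{z \in \mathbb{C} : |z| \le 1\}$ and $R_w = \{z \in \overline{\mathbb{D}} : \rho_w(z) = 1\}$. The braid $w$ is pseudo-Anosov when the mapping class of the 3-punctured disc it induces is pseudo-Anosov (after capping the boundary with a punctured disc, i.e. as a mapping class of the 4-punctured sphere); equivalently $|\mathrm{tr}\, B_{-1}(w)| > 2$. *)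

(* Defs.v *)
From HB Require Import structures.
From mathcomp Require Import all_boot all_order all_algebra all_fingroup.
From mathcomp Require Import generic_quotient boolp classical_sets reals.
From mathcomp Require Import complex ring.

Set Implicit Arguments.
Unset Strict Implicit.
Unset Printing Implicit Defensive.

Import Order.TTheory GRing.Theory Num.Theory.
Local Open Scope ring_scope.
Local Open Scope quotient_scope.
Local Open Scope complex_scope.
Local Open Scope classical_set_scope.

(* The letter (i, false) stands for sigma_(i+1), and (i, true) for its
   inverse. *)
Notation letter := ('I_2 * bool)%type.
Notation word := (seq letter).

Definition s1 : letter := (ord0, false).
Definition s2 : letter := (ord_max, false).

Definition inv_letter (a : letter) : letter := (a.1, ~~ a.2).
Definition inv_word (u : word) : word := rev (map inv_letter u).

Inductive braid_eq : word -> word -> Prop :=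
| Braid_refl u : braid_eq u u
| Braid_sym u v : braid_eq u v -> braid_eq v u
| Braid_trans u v w : braid_eq u v -> braid_eq v w -> braid_eq u w
| Braid_cat u u' v v' :
    braid_eq u u' -> braid_eq v v' -> braid_eq (u ++ v) (u' ++ v')
| Braid_cancel a : braid_eq [:: a; inv_letter a] [::]
| Braid_rel : braid_eq [:: s1; s2; s1] [:: s2; s1; s2].

Lemma inv_letterK : involutive inv_letter.
Proof. by case=> i b; rewrite /inv_letter negbK. Qed.

Lemma inv_word_cat u v : inv_word (u ++ v) = inv_word v ++ inv_word u.
Proof. by rewrite /inv_word map_cat rev_cat. Qed.

Lemma braid_eq_mulV u : braid_eq (u ++ inv_word u) [::].
Proof.
elim: u => [|a u IH]; first exact: Braid_refl.
rewrite -cat1s inv_word_cat -catA (catA u).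
apply: Braid_trans (Braid_cancel a).
apply: (@Braid_cat [:: a] [:: a]); first exact: Braid_refl.
exact: (Braid_cat IH (Braid_refl (inv_word [:: a]))).
Qed.

Lemma inv_wordK : involutive inv_word.
Proof.
move=> u; rewrite /inv_word map_rev revK -map_comp -[RHS]map_id.
by apply: eq_map => a /=; rewrite inv_letterK.
Qed.

Lemma braid_eq_mulg1_unique u v : braid_eq (u ++ v) [::] ->
  braid_eq v (inv_word u).
Proof.
move=> uv; have Vu : braid_eq (inv_word u ++ u) [::].
  by have := braid_eq_mulV (inv_word u); rewrite inv_wordK.
apply: (@Braid_trans _ ((inv_word u ++ u) ++ v)).
  exact/Braid_sym/(Braid_cat Vu (Braid_refl v)).
rewrite -catA -[X in braid_eq _ X]cats0.
exact: (Braid_cat (Braid_refl _) uv).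
Qed.

Lemma braid_eq_inv u v : braid_eq u v -> braid_eq (inv_word u) (inv_word v).
Proof.
move=> uv; apply: braid_eq_mulg1_unique.
apply: Braid_trans (braid_eq_mulV u).
exact: (Braid_cat (Braid_sym uv) (Braid_refl _)).
Qed.

Definition braid_eqb : rel word := fun u v => `[< braid_eq u v >].

Lemma braid_eqb_refl : reflexive braid_eqb.
Proof. by move=> u; apply/asboolP/Braid_refl. Qed.

Lemma braid_eqb_sym : symmetric braid_eqb.
Proof. by move=> u v; apply/asboolP/asboolP; apply: Braid_sym. Qed.

Lemma braid_eqb_trans : transitive braid_eqb.
Proof.
by move=> v u w /asboolP uv /asboolP vw; apply/asboolP/(Braid_trans uv vw).
Qed.

Canonical braid_equiv :=
  EquivRel braid_eqb braid_eqb_refl braid_eqb_sym braid_eqb_trans.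

Definition Br3 := {eq_quot braid_equiv}.
HB.instance Definition _ := Choice.on Br3.
HB.instance Definition _ := EqQuotient.on Br3.

Lemma Br3P (u v : word) : \pi_Br3 u = \pi_Br3 v <-> braid_eq u v.
Proof. by split=> [/eqmodP/asboolP|/asboolP uv]; last apply/eqmodP. Qed.

Lemma braid_eq_repr (u : word) : braid_eq (repr (\pi_Br3 u)) u.
Proof. by apply/Br3P; rewrite reprK. Qed.

Definition Br3_one : Br3 := \pi_Br3 [::].
Definition Br3_mul (x y : Br3) : Br3 := \pi_Br3 (repr x ++ repr y).
Definition Br3_inv (x : Br3) : Br3 := \pi_Br3 (inv_word (repr x)).

Lemma Br3_mul_pi u v : Br3_mul (\pi_Br3 u) (\pi_Br3 v) = \pi_Br3 (u ++ v).
Proof. by apply/Br3P/Braid_cat; apply: braid_eq_repr. Qed.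

Lemma Br3_inv_pi u : Br3_inv (\pi_Br3 u) = \pi_Br3 (inv_word u).
Proof. exact/Br3P/braid_eq_inv/braid_eq_repr. Qed.

Lemma Br3_mulA : associative Br3_mul.
Proof.
elim/(@quotW _ Br3)=> u; elim/(@quotW _ Br3)=> v; elim/(@quotW _ Br3)=> w.
by rewrite !Br3_mul_pi catA.
Qed.

Lemma Br3_mul1 : left_id Br3_one Br3_mul.
Proof. by elim/(@quotW _ Br3)=> u; rewrite Br3_mul_pi. Qed.

Lemma Br3_mulr1 : right_id Br3_one Br3_mul.
Proof. by elim/(@quotW _ Br3)=> u; rewrite Br3_mul_pi cats0. Qed.

Lemma Br3_mulrV : right_inverse Br3_one Br3_inv Br3_mul.
Proof.
elim/(@quotW _ Br3)=> u; rewrite Br3_inv_pi Br3_mul_pi.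
exact/Br3P/braid_eq_mulV.
Qed.

Lemma Br3_mulV : left_inverse Br3_one Br3_inv Br3_mul.
Proof.
elim/(@quotW _ Br3)=> u; rewrite Br3_inv_pi Br3_mul_pi -[X in _ ++ X]inv_wordK.
exact/Br3P/braid_eq_mulV.
Qed.

HB.instance Definition _ :=
  isGroup.Build Br3 Br3_mulA Br3_mul1 Br3_mulr1 Br3_mulV Br3_mulrV.

Definition sigma (i : 'I_2) : Br3 := \pi_Br3 [:: (i, false)].

Definition positive (w : Br3) : Prop :=
  exists u : seq 'I_2, w = (\prod_(i <- u) sigma i)%g.

Definition burau_gen (A : comUnitRingType) (t : A) (i : 'I_2) : 'M[A]_2 :=
  if i == ord0
  then \matrix_(j, k) (nth [::] [:: [:: - t; 1]; [:: 0; 1]] j)`_k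
  else \matrix_(j, k) (nth [::] [:: [:: 1; 0]; [:: t; - t]] j)`_k.

Definition burau_letter (A : comUnitRingType) (t : A) (a : letter) : 'M[A]_2 :=
  if a.2 then (burau_gen t a.1)^-1 else burau_gen t a.1.

Definition burau_word (A : comUnitRingType) (t : A) (u : word) : 'M[A]_2 :=
  \prod_(a <- u) burau_letter t a.

(* Independent of the representative, and multiplicative, only when t is a
   unit: see burau_pi and burauM. *)
Definition burau (A : comUnitRingType) (t : A) (w : Br3) : 'M[A]_2 :=
  burau_word t (repr w).

Section BurauUnit.
Variables (A : comUnitRingType) (t : A).
Hypothesis tU : t \is a GRing.unit.

Lemma burau_gen_unit i : burau_gen t i \is a GRing.unit.
Proof.
rewrite -[_ \is a _]/(_ \in unitmx) unitmxE.
rewrite (_ : \det _ = - t) ?unitrN // (expand_det_row _ ord0) !big_ord_recl.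
by rewrite big_ord0 /cofactor !det_mx11 /burau_gen; case: ifP => _;
  rewrite !mxE /=; ring.
Qed.

Lemma burau_word_eq u v : braid_eq u v -> burau_word t u = burau_word t v.
Proof.
elim=> {u v}[||u v w _ -> _ ->||[i b]|] //.
- by move=> u u' v v' _ Hu _ Hv; rewrite /burau_word !big_cat -/(burau_word t u)
    -/(burau_word t v) -/(burau_word t u') -/(burau_word t v') Hu Hv.
- rewrite /burau_word !big_cons !big_nil mulr1 /burau_letter /=.
  by case: b; rewrite /= ?mulVr ?divrr // burau_gen_unit.
- rewrite /burau_word !big_cons !big_nil !mulr1 /burau_letter /burau_gen /=.
  apply/matrixP=> i j; rewrite !(mxE, big_ord_recl, big_ord0) /=.
  by case: i => [[|[|?]] ?] //; case: j => [[|[|?]] ?] //=; ring.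
Qed.

Lemma burau_pi u : burau t (\pi_Br3 u) = burau_word t u.
Proof. exact/burau_word_eq/braid_eq_repr. Qed.

Lemma burauM x y : burau t (x * y)%g = burau t x * burau t y.
Proof.
elim/(@quotW _ Br3): x => u; elim/(@quotW _ Br3): y => v.
by rewrite [(_ * _)%g]Br3_mul_pi !burau_pi /burau_word big_cat.
Qed.

End BurauUnit.

(* Z[t, t^-1] is a subring of its field of fractions Q(t), in which the
   indeterminate t is invertible. *)
Definition burau_generic (w : Br3) : 'M[{fraction {poly int}}]_2 :=
  burau (tofrac ('X : {poly int})) w.

(* Each entry of the Burau matrix, as a polynomial in t; the default value 0
   is irrelevant when w is positive, see burau_polyE. *)
Definition burau_poly (w : Br3) : 'M[{poly int}]_2 :=
  \matrix_(i, j) xget 0 [set p : {poly int} | tofrac p = burau_generic w i j].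

Lemma burau_polyE w : positive w ->
  map_mx (@tofrac {poly int}) (burau_poly w) = burau_generic w.
Proof.
move=> [u ->].
have Xu : tofrac ('X : {poly int}) \is a GRing.unit.
  by rewrite unitfE tofrac_eq0 polyX_eq0.
suff [P HP] : exists P : 'M[{poly int}]_2,
    burau_generic (\prod_(i <- u) sigma i)%g = map_mx (@tofrac _) P.
  apply/matrixP=> i j; rewrite !mxE; case: xgetP => // /(_ (P i j)).
  by rewrite HP !mxE; case.
elim: u => [|i u [P IH]].
  exists 1; rewrite big_nil /burau_generic [burau _ _](burau_pi Xu [::]).
  by rewrite /burau_word big_nil map_mx1.
exists (burau_gen 'X i * P); rewrite big_cons /burau_generic burauM // map_mxM.
rewrite -IH; congr (_ * _); rewrite [LHS](burau_pi Xu) /burau_word big_seq1.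
rewrite /burau_letter /burau_gen /=; case: ifP => _; apply/matrixP=> j k;
  by rewrite !mxE; case: j => [[|[|?]] ?]; case: k => [[|[|?]] ?] //=;
    rewrite ?(tofrac0, tofrac1, tofracN).
Qed.

(* The double cover of the sphere branched at the four punctures is a torus,
   and the mapping class of w lifts to it with action on homology given, up to
   sign and conjugacy, by the Burau matrix at t = -1.  The mapping class is
   pseudo-Anosov exactly when this matrix of determinant 1 is hyperbolic. *)
Definition pseudo_anosov (w : Br3) : Prop :=
  2 < `|\tr (burau (-1 : int) w)|.

(* The closed braid diagram of a word u: the point (k, i) is the position i at
   level k, the k-th letter a crosses the positions a.1 and a.1 + 1 between
   the levels k and k + 1, and the last level is glued back to the first. *)
Definition crossing (a : letter) : 'S_3 := tperm (inord a.1) (inord a.1.+1).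

Definition closure_step (u : word) (x : 'I_(size u).+1 * 'I_3) :
    'I_(size u).+1 * 'I_3 :=
  if (x.1 < size u)%N then (inord x.1.+1, crossing (nth s1 u x.1) x.2)
  else (ord0, x.2).

(* The closure is a knot when it has a single component. *)
Definition closure_is_knot_word (u : word) : Prop :=
  forall x y, fconnect (@closure_step u) x y.

Definition closure_is_knot (w : Br3) : Prop := closure_is_knot_word (repr w).

Definition word_perm (u : word) : 'S_3 := (\prod_(a <- u) crossing a)%g.

Lemma iter_closure_step u k i : (k <= size u)%N ->
  iter k (@closure_step u) (ord0, i) = (inord k, word_perm (take k u) i).
Proof.
elim: k => [_|k IH ku] /=.
  by rewrite take0 /word_perm big_nil perm1; congr (_, _); apply/val_inj;
    rewrite /= inordK.
rewrite IH ?(ltnW ku) // /closure_step /= inordK ?ltnS ?(ltnW ku) // ku.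
by rewrite (take_nth s1 ku) /word_perm -cats1 big_cat big_seq1 permM.
Qed.

Lemma iter_closure_loop u m i :
  iter (m * (size u).+1) (@closure_step u) (ord0, i) =
  (ord0, iter m (word_perm u) i).
Proof.
elim: m => [|m IH]; first by rewrite mul0n.
rewrite mulSn iterD IH iterS iter_closure_step // take_size /closure_step /=.
by rewrite inordK ?ltnSn // ltnn.
Qed.

Lemma closure_is_knot_wordE u :
  closure_is_knot_word u <-> forall i j, fconnect (word_perm u) i j.
Proof.
split=> [knot i j | trans [k i] [l j]].
  have := iter_findex (knot (ord0, i) (ord0, j)).
  set n := findex _ _ _; rewrite (divn_eq n (size u).+1) addnC iterD.
  rewrite iter_closure_loop iter_closure_step; last by rewrite -ltnS ltn_mod.
  move=> [/(congr1 val)]; rewrite /= inordK ?ltn_mod // => ->.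
  rewrite take0 /word_perm big_nil perm1 => <-.
  exact: fconnect_iter.
have down m : forall (k : 'I_(size u).+1) i, (k + m = size u)%N ->
    exists i', fconnect (@closure_step u) (k, i) (ord0, i').
  elim: m => [|m IH] {}k {}i km.
    exists i; apply: connect1; rewrite /= /closure_step /=.
    by move: km; rewrite addn0 => ->; rewrite ltnn.
  have ku : (k < size u)%N.
    by apply: leq_trans (leq_addr m k.+1) _; rewrite addSnnS km.
  have [|i' Hi'] := IH (inord k.+1) (crossing (nth s1 u k) i).
    by rewrite inordK ?ltnS // addSnnS.
  exists i'; apply: connect_trans Hi'; apply: connect1.
  by rewrite /= /closure_step /= ku.
have [i' Hi'] := down (size u - k)%N k i (subnKC (leq_ord k)).
apply: connect_trans Hi' _.
pose j' := (word_perm (take l u))^-1%g j.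
apply: (@connect_trans _ _ (ord0, j')).
  rewrite -(iter_findex (trans i' j')) -iter_closure_loop.
  exact: fconnect_iter.
have <- : iter l (@closure_step u) (ord0, j') = (l, j).
  by rewrite iter_closure_step ?leq_ord // inord_val permKV.
exact: fconnect_iter.
Qed.

Lemma word_perm_eq u v : braid_eq u v -> word_perm u = word_perm v.
Proof.
elim=> {u v}[||u v w _ -> _ ->||a|] //.
- by move=> u u' v v' _ Hu _ Hv; rewrite /word_perm !big_cat -/(word_perm u)
    -/(word_perm v) -/(word_perm u') -/(word_perm v') Hu Hv.
- by rewrite /word_perm !big_cons !big_nil mulg1 /crossing tperm2.
- rewrite /word_perm !big_cons !big_nil !mulg1 /crossing /=.
  set a : 'I_3 := inord 0; set b : 'I_3 := inord 1; set c : 'I_3 := inord 2.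
  have ab : a != b by rewrite -val_eqE /= !inordK.
  have ac : a != c by rewrite -val_eqE /= !inordK.
  have bc : b != c by rewrite -val_eqE /= !inordK.
  have conj x y (s : {perm 'I_3}) :
      (tperm x y * (s * tperm x y) = s ^ tperm x y)%g.
    by rewrite conjgE tpermV.
  rewrite !conj !tpermJ tpermR tpermL.
  by rewrite !tpermD // 1?eq_sym // tpermC.
Qed.

Lemma closure_is_knot_pi u :
  closure_is_knot (\pi_Br3 u) <-> closure_is_knot_word u.
Proof.
rewrite /closure_is_knot !closure_is_knot_wordE.
by rewrite (word_perm_eq (braid_eq_repr u)).
Qed.

(* The set of eigenvalues is finite and nonempty when 0 < n, so that the
   supremum is then a maximum. *)
Definition spectral_radius (R : realType) (n : nat) (M : 'M[R[i]]_n) : R :=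
  sup [set complex.Re `|a| | a in [set a | eigenvalue M a]].

Definition rho (R : realType) (w : Br3) (z : R[i]) : R :=
  spectral_radius (map_mx (fun p => (map_poly intr p).[z]) (burau_poly w)).

Definition closed_disc (R : realType) : set R[i] := [set z | `|z| <= 1].

Definition real_axis (R : realType) : set R[i] := [set z | complex.Im z = 0].

Arguments real_axis : clear implicits.

Definition Rset (R : realType) (w : Br3) : set R[i] :=
  [set z | closed_disc z /\ rho w z = 1].
Arguments Rset : clear implicits.

(* Main.v *)
Require Import Defs.
From mathcomp Require Import all_boot all_order all_algebra all_fingroup.
From mathcomp Require Import generic_quotient boolp classical_sets reals.
From mathcomp Require Import complex.
From mathcomp Require Import ring lra zify.

(** Write p(t) and d(t) for the trace and the determinant of the Burau matrix of
w, of length n.  The permutation of w is a 3-cycle, so n is even and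
d(t) = t^n lies in [0, 1] on [-1, 1].  For a real matrix of size two with such
a determinant, the spectral radius is 1 if and only if |p| = 1 + d, or d = 1
and |p| <= 2 (spectral_radius_eq1).

For 0 < t <= 1 there is an inner product, qform, for which both generators are
self-adjoint with eigenvalues 1 and -t, hence contractions.  When t < 1, only
the vectors that it fixes keep their norm under a generator, and no nonzero
vector is fixed by both; as both occur in w, neither 1 nor -1 is an
eigenvalue, which excludes |p| = 1 + d.  At t = 1 the contraction only gives
|p| <= 2, and the spectral radius is 1.

For t = -s with 0 <= s <= 1, grouping the letters of w into syllables writes
the matrix, up to conjugacy and a factor (-s)^r, as a product of 2r matrices
block s (a - 1) = ( [a], -s^(a-1) ; 1, 0 ), the matrices of the quantum
continued fractions of Morier-Genoud and Ovsienko (burau_pos_blocks).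
Blowing down the entries a = 1 of this cyclic sequence ends either with
|p(-1)| <= 2, excluded since w is pseudo-Anosov, or with a sequence of
entries a >= 2 (blocks_nonhyperbolic_or_positive).  In the latter case a shear
conjugates all blocks to matrices with nonnegative coefficients in s.  Thus
|p(-s)| = q(s) for a polynomial q with nonnegative coefficients, all of them
in degrees strictly between 0 and n (trace_burau_neg).

The unitarity of the Burau representation gives s^n q(1/s) = q(s), so 2 q(s)
is a nonnegative combination of sums s^i + s^(n-i) with 0 < i < n.  The
quotient of each of them by 1 + s^n increases strictly on [0, 1], because
in terms of s = exp (-x) it has the form cosh (j x) / cosh (m x) with
0 <= j < m, which decreases in x > 0.  So q(s) = 1 + s^n has
at most one solution in [0, 1] (balanced_increasing).  It is not s = 1, where
q = |p(-1)| > 2.  Finally let s = phi^2 = (3 - sqrt 5) / 2 with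
phi^2 + phi = 1.  There each block multiplied by phi = sqrt s maps the positive
vector (phi, 1) below itself, and so does the whole matrix; hence
q(s) <= 1 + s^n, and the solution exists and is at least (3 - sqrt 5) / 2. *)

Set Implicit Arguments.
Unset Strict Implicit.
Unset Printing Implicit Defensive.

Import Order.TTheory GRing.Theory Num.Theory.
Local Open Scope ring_scope.
Local Open Scope classical_set_scope.
Local Open Scope complex_scope.

(** * Two-by-two matrices and Burau matrices of positive words *)

Definition mx2 (A : Type) (a b c d : A) : 'M[A]_2 :=
  \matrix_(i, j) (if i == ord0 then if j == ord0 then a else b
                  else if j == ord0 then c else d).
Arguments mx2 {A}.

Section Mx2.
Variable A : comNzRingType.
Implicit Types (a b c d x y z t : A) (X Y Z : 'M[A]_2).

Lemma mx2_eta X : X = mx2 (X ord0 ord0) (X ord0 ord_max)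
                          (X ord_max ord0) (X ord_max ord_max).
Proof.
apply/matrixP => i j; rewrite mxE.
by case: i => [[|[|//]] ?]; case: j => [[|[|//]] ?] /=; congr (X _ _);
  apply: val_inj.
Qed.

Lemma mx2M a b c d x y z t : mx2 a b c d * mx2 x y z t =
  mx2 (a * x + b * z) (a * y + b * t) (c * x + d * z) (c * y + d * t).
Proof.
apply/matrixP => i j; rewrite !mxE !big_ord_recl big_ord0 addr0 !mxE /=.
by case: (i == ord0); case: (j == ord0).
Qed.

Lemma mx2Z k a b c d : k *: mx2 a b c d = mx2 (k * a) (k * b) (k * c) (k * d).
Proof. by apply/matrixP => i j; rewrite !mxE; do 2?case: ifP. Qed.

Lemma mx2_1 : 1 = mx2 1 0 0 1 :> 'M[A]_2.
Proof.
by apply/matrixP => i j; rewrite !mxE;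
  case: i => [[|[|//]] ?]; case: j => [[|[|//]] ?].
Qed.

Lemma mxtrace_mx2 a b c d : \tr (mx2 a b c d) = a + d.
Proof. by rewrite /mxtrace !big_ord_recl big_ord0 addr0 !mxE. Qed.

Lemma det_mx2 a b c d : \det (mx2 a b c d) = a * d - b * c.
Proof.
rewrite (expand_det_row _ ord0) !big_ord_recl big_ord0 /cofactor !det_mx11.
by rewrite !mxE /=; ring.
Qed.

Lemma det_mulr X Y : \det (X * Y) = \det X * \det Y.
Proof. exact: det_mulmx. Qed.

Lemma map_mx2 (B : comNzRingType) (f : A -> B) a b c d :
  map_mx f (mx2 a b c d) = mx2 (f a) (f b) (f c) (f d).
Proof. by apply/matrixP => i j; rewrite !mxE; do 2?case: ifP. Qed.

(** In size two, trace and determinant amount to the characteristic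
polynomial.  Over an arbitrary ring this relation is easier to transport than
similarity: it is stable under scaling and under cyclic rotation of a
product. *)
Definition same_char X Y := \tr X = \tr Y /\ \det X = \det Y.

Lemma same_char_refl X : same_char X X.
Proof. by []. Qed.

Lemma same_char_trans Y X Z :
  same_char X Y -> same_char Y Z -> same_char X Z.
Proof. by rewrite /same_char => -[-> ->]. Qed.

Lemma same_charC X Y : same_char (X * Y) (Y * X).
Proof. by split; [apply: mxtrace_mulC | rewrite !det_mulr mulrC]. Qed.

Lemma same_charZ k X Y : same_char X Y -> same_char (k *: X) (k *: Y).
Proof. by case=> trXY detXY; split; rewrite ?mxtraceZ ?detZ ?trXY ?detXY. Qed.

Lemma mulr_mxE X Y i j :
  (X * Y) i j = X i ord0 * Y ord0 j + X i ord_max * Y ord_max j.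
Proof.
rewrite mxE !big_ord_recl big_ord0 addr0; congr (_ + X _ _ * Y _ _);
  exact: val_inj.
Qed.

End Mx2.
Arguments same_char {A}.

(** The matrix of a positive word makes sense at every t, in particular
at t = 0 and over polynomials, where the generators are not invertible. *)
Definition burau_pos (A : comUnitRingType) (t : A) (u : seq 'I_2) : 'M[A]_2 :=
  \prod_(i <- u) burau_gen t i.

Lemma burau_genE (A : comUnitRingType) (t : A) (i : 'I_2) :
  burau_gen t i = if i == ord0 then mx2 (- t) 1 0 1 else mx2 1 0 t (- t).
Proof.
by rewrite /burau_gen; case: ifP => _; apply/matrixP => j k; rewrite !mxE;
  case: j => [[|[|//]] ?]; case: k => [[|[|//]] ?].
Qed.

Lemma det_burau_pos (A : comUnitRingType) (t : A) u :
  \det (burau_pos t u) = (- t) ^+ size u.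
Proof.
rewrite /burau_pos; elim: u => [|i u IH]; first by rewrite big_nil det1.
rewrite big_cons det_mulr IH exprS burau_genE.
by case: ifP => _; rewrite det_mx2; congr (_ * _); ring.
Qed.

Lemma map_burau_pos (A B : comUnitRingType) (f : {rmorphism A -> B}) t u :
  map_mx f (burau_pos t u) = burau_pos (f t) u.
Proof.
rewrite /burau_pos; elim: u => [|i u IH]; first by rewrite !big_nil map_mx1.
rewrite !big_cons map_mxM IH !burau_genE; congr (_ * _).
by case: ifP => _; rewrite map_mx2 rmorph0 rmorph1 rmorphN.
Qed.

(** * Matrices of quantum continued fractions *)

Section Blocks.
Variable A : comNzRingType.
Implicit Types (s : A) (b : seq nat).

(** The quantum integer [n]. *)
Definition qint s n : A := \sum_(i < n) s ^+ i.

Lemma qint0 s : qint s 0 = 0.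
Proof. by rewrite /qint big_ord0. Qed.

Lemma qintS s n : qint s n.+1 = 1 + s * qint s n.
Proof.
rewrite /qint big_ord_recl mulr_sumr; congr (_ + _).
by apply: eq_bigr => i _; rewrite -exprS.
Qed.

Lemma qintSr s n : qint s n.+1 = qint s n + s ^+ n.
Proof. by rewrite /qint big_ord_recr. Qed.

(** The matrix of a quantum continued fraction with entry n + 1.  The
shift makes all natural numbers legal indices, index 0 being the one that can
be blown down. *)
Definition block s n : 'M[A]_2 := mx2 (qint s n.+1) (- s ^+ n) 1 0.

Definition blocks s b : 'M[A]_2 := \prod_(n <- b) block s n.

(** At t = -s, the matrix of the half twist sigma_1 sigma_2 sigma_1 is
s times this one. *)
Definition half_twist s : 'M[A]_2 := mx2 0 1 (- s) 0.

Lemma qintD s m n : qint s (m + n) = qint s m + s ^+ m * qint s n.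
Proof.
elim: n => [|n IH]; first by rewrite addn0 qint0; ring.
by rewrite addnS !qintSr IH exprD; ring.
Qed.

(** Substituting this for the powers of s turns identities between them
and quantum integers into polynomial identities in the latter, which ring
decides. *)
Lemma exprn_qint s n : s ^+ n = 1 - (1 - s) * qint s n.
Proof.
by apply: (addrI (qint s n)); rewrite -qintSr qintS; ring.
Qed.

(** The matrix of sigma_1^(n+1) is block s n * half_twist s, so this is
the addition of exponents. *)
Lemma block_merge s m n :
  block s m * half_twist s * block s n = block s (m + n).+1.
Proof.
rewrite /block /half_twist !mx2M -addSn -addnS qintD !exprD !exprS.
by congr mx2; ring.
Qed.

Lemma half_twist_sqr s : half_twist s * half_twist s = - s *: 1.
Proof. by rewrite /half_twist mx2_1 mx2M mx2Z; congr mx2; ring. Qed.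

(** The blow-down of negative continued fractions, which replaces the
consecutive entries a, 1, b by a - 1, b - 1. *)
Lemma blow_down s m n :
  block s m.+1 * block s 0 * block s n.+1 = s *: (block s m * block s n).
Proof.
rewrite /block !mx2M mx2Z !qintS qint0 !exprS expr0 !exprn_qint.
by congr mx2; ring.
Qed.

(** When two consecutive entries are 1, a blow-down would leave an
entry 0; eliminating that one in turn makes its two neighbours add up. *)
Lemma blow_down2 s m n :
  block s m * block s 0 * block s 0 * block s n = - block s (m + n).
Proof.
rewrite -scaleN1r /block !mx2M mx2Z -addSn qintD !qintS qint0 !exprD !exprS.
by rewrite expr0 !exprn_qint; congr mx2; ring.
Qed.

(** In a cyclic sequence of length two, the two neighbours of the
entry 1 are the same entry, which the blow-down decreases twice. *)
Lemma blow_down_pair s n :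
  same_char (block s 0 * block s n.+2) (s *: block s n).
Proof.
rewrite /block mx2M mx2Z /same_char !mxtrace_mx2 !det_mx2 !qintS qint0 !exprS.
by rewrite expr0 exprn_qint; split; ring.
Qed.

Lemma block0_cube s n :
  block s 0 * block s 0 * block s n = mx2 (-1) 0 (s * qint s n) (- s ^+ n).
Proof.
rewrite /block !mx2M !qintS qint0 expr0 !exprn_qint.
by congr mx2; ring.
Qed.

Definition pos_block s n : 'M[A]_2 := mx2 (s * qint s n.+1) (s * qint s n) 1 1.

(** A single shear removes the minus sign of all the blocks of
positive index at once.  Index 0 has to be excluded: block s 0 has trace and
determinant 1, unlike any matrix with nonnegative real entries. *)
Lemma block_pos_conj s n :
  block s n.+1 * mx2 1 1 0 1 = mx2 1 1 0 1 * pos_block s n.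
Proof.
rewrite /block !mx2M !qintS !exprS exprn_qint.
by congr mx2; ring.
Qed.

Definition pos_blocks s c : 'M[A]_2 := \prod_(n <- c) pos_block s n.

Lemma blocks_pos_conj s c :
  same_char (blocks s (map succn c)) (pos_blocks s c).
Proof.
pose C : 'M[A]_2 := mx2 1 1 0 1; pose C' : 'M[A]_2 := mx2 1 (-1) 0 1.
have CC' : C * C' = 1 by rewrite mx2M mx2_1; congr mx2; ring.
have C'C : C' * C = 1 by rewrite mx2M mx2_1; congr mx2; ring.
have conj : blocks s (map succn c) * C = C * pos_blocks s c.
  rewrite /blocks /pos_blocks big_map; elim: c => [|n c IH].
    by rewrite !big_nil mulr1 mul1r.
  by rewrite !big_cons -mulrA IH !mulrA block_pos_conj.
rewrite -[blocks _ _]mulr1 -CC' mulrA conj -mulrA.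
by apply: same_char_trans (same_charC _ _) _; rewrite -mulrA C'C mulr1.
Qed.

End Blocks.

Lemma blocks_cons (A : comNzRingType) (s : A) n b :
  blocks s (n :: b) = block s n * blocks s b.
Proof. exact: big_cons. Qed.

Lemma blocks_cat (A : comNzRingType) (s : A) b c :
  blocks s (b ++ c) = blocks s b * blocks s c.
Proof. exact: big_cat. Qed.

Lemma blocks_rcons (A : comNzRingType) (s : A) b n :
  blocks s (rcons b n) = blocks s b * block s n.
Proof. by rewrite -cats1 blocks_cat /blocks big_seq1. Qed.

Section Map.
Variables (A B : comNzRingType) (f : {rmorphism A -> B}).

Lemma map_qint s n : f (qint s n) = qint (f s) n.
Proof. by rewrite rmorph_sum; apply: eq_bigr => i _; rewrite rmorphXn. Qed.

Lemma map_pos_blocks s c : map_mx f (pos_blocks s c) = pos_blocks (f s) c.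
Proof.
rewrite /pos_blocks; elim: c => [|n c IH]; first by rewrite !big_nil map_mx1.
rewrite !big_cons map_mxM IH; congr (_ * _).
by rewrite /pos_block map_mx2 !rmorphM !map_qint rmorph1.
Qed.

End Map.

(** * Positive words as products of blocks *)

Lemma burau_genN (A : comUnitRingType) (s : A) (i : 'I_2) : burau_gen (- s) i =
  if i == ord0 then block s 0 * half_twist s else half_twist s * block s 0.
Proof.
rewrite burau_genE opprK /block /half_twist !mx2M !qintS !qint0 expr0.
by case: ifP => _; congr mx2; ring.
Qed.

(** A letter put in front of a word either prolongs the first syllable,
which is block_merge, or opens a new one.  The flags record the half twists
left at the ends: x when the word starts with sigma_2, y when it ends with
sigma_1.  A letter has as many blocks as half twists, and a merge removes one
of each; as k counts the squares of half twists turned into scalars, this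
gives the equation on the number of blocks. *)
Lemma word_blocks i u : exists (x y : bool) k n b,
  [/\ (size b).+1 = (2 * k + x + y)%N,
      size (i :: u) = (sumn (n :: b) + (size b).+1)%N
    & forall (A : comUnitRingType) (s : A), burau_pos (- s) (i :: u) =
        (- s) ^+ k *:
          (half_twist s ^+ x * blocks s (n :: b) * half_twist s ^+ y)].
Proof.
elim: u i => [|j u IH] i.
  case: (eqVneq i ord0) => i0.
    exists false, true, 0%N, 0%N, [::]; split=> // A s.
    by rewrite /burau_pos /blocks !big_seq1 burau_genN i0 eqxx scale1r mul1r.
  exists true, false, 0%N, 0%N, [::]; split=> // A s.
  by rewrite /burau_pos /blocks !big_seq1 burau_genN (negPf i0) scale1r mulr1.
have [x [y [k [n [b [szb szu E]]]]]] := IH j.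
have Econs (A : comUnitRingType) (s : A) : burau_pos (- s) [:: i, j & u] =
    burau_gen (- s) i * burau_pos (- s) (j :: u) by exact: big_cons.
case: (eqVneq i ord0) => i0; case: x szb E => szb E.
- exists false, y, k.+1, 0%N, (n :: b); split=> [||A s] /=.
  + by rewrite szb; lia.
  + by rewrite /= in szu *; lia.
  rewrite Econs E burau_genN i0 eqxx [blocks s (0%N :: _)]blocks_cons.
  rewrite -scalerAr expr1 mul1r !mulrA.
  rewrite -(mulrA (block s 0) (half_twist s) (half_twist s)) half_twist_sqr.
  by rewrite -scalerAr mulr1 -!scalerAl scalerA exprSr.
- exists false, y, k, n.+1, b; split=> [||A s] //=.
  + by rewrite /= in szu *; lia.
  rewrite Econs E burau_genN i0 eqxx !blocks_cons -(block_merge s 0 n).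
  by rewrite -scalerAr !mul1r !mulrA.
- exists true, y, k, n.+1, b; split=> [||A s] //=.
  + by rewrite /= in szu *; lia.
  rewrite Econs E burau_genN (negPf i0) !blocks_cons -(block_merge s 0 n).
  by rewrite -scalerAr expr1 !mulrA.
- exists true, y, k, 0%N, (n :: b); split=> [||A s] //=.
  + by rewrite szb; lia.
  + by rewrite /= in szu *; lia.
  rewrite Econs E burau_genN (negPf i0) [blocks s (0%N :: _)]blocks_cons.
  by rewrite -scalerAr expr1 mul1r !mulrA.
Qed.

(** Conjugation brings together the half twists left at the two
ends.  When the word starts and ends with the same letter, its first and last
syllables are cyclically one, and their blocks merge.  The exception is a word
with a single syllable, a power of a generator, of trace 2 at t = -1. *)
Lemma burau_pos_blocks u :
  `|\tr (burau_pos (-1 : int) u)| <= 2 \/ exists r b,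
  [/\ (0 < r)%N, size b = (2 * r)%N, size u = (sumn b + size b)%N
    & forall (A : comUnitRingType) (s : A),
        same_char (burau_pos (- s) u) ((- s) ^+ r *: blocks s b)].
Proof.
case: u => [|i u].
  by left; rewrite /burau_pos big_nil mxtrace1 .
have [x [y [k [n [b [szb szu E]]]]]] := word_blocks i u.
have [xy|xy] := eqVneq x y.
  right; exists (k + x)%N, (n :: b); split=> [||//|A s] /=.
  - by rewrite -xy in szb; case: x {xy E} szb => /=; lia.
  - by rewrite szb -xy; lia.
  rewrite E -xy; case: (x); last first.
    by rewrite addn0 mul1r mulr1; exact: same_char_refl.
  rewrite addn1 exprSr -scalerA; apply: same_charZ.
  apply: same_char_trans (same_charC _ _) _; rewrite mulrA !expr1.
  by rewrite half_twist_sqr -scalerAl mul1r; exact: same_char_refl.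
have {E} E (A : comUnitRingType) (s : A) : same_char (burau_pos (- s) (i :: u))
    ((- s) ^+ k *: (half_twist s * blocks s (n :: b))).
  rewrite E; apply: same_charZ; case: x y xy {szb E} => [] [] // _.
    by rewrite mulr1 expr1; exact: same_char_refl.
  by rewrite mul1r expr1; exact: same_charC.
have {x y xy} szb : size b = (2 * k)%N by case: x y xy szb => [] [] //=; lia.
case: (lastP b) szb szu E => [|b' m] szb szu E.
  left; have [-> _] := E int 1; have -> : k = 0%N by move: szb => /=; lia.
  rewrite expr0 scale1r /blocks big_seq1 /half_twist mx2M mxtrace_mx2.
  by rewrite exprn_qint; lia.
right; exists k, ((n + m).+1 :: b'); split=> [|||A s].
- by rewrite size_rcons in szb; lia.
- by rewrite -szb size_rcons.
- by rewrite szu /= sumn_rcons size_rcons; lia.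
apply: same_char_trans (E _ _) _; apply: same_charZ.
rewrite !blocks_cons blocks_rcons !mulrA.
apply: same_char_trans (same_charC _ _) _.
by rewrite !mulrA block_merge addnC; exact: same_char_refl.
Qed.

(** * Blowing down cyclic sequences of blocks *)

(** Quantifying over all rings makes the sign and the exponent independent
of s, so that one reduction serves s = 1, real s and indeterminate s. *)
Definition reduces b c := exists (e : bool) j,
  forall (A : comNzRingType) (s : A),
    same_char (blocks s b) (((-1) ^+ e * s ^+ j) *: blocks s c).

Lemma reduces_rot n b : reduces b (rot n b).
Proof.
exists false, 0%N => A s; rewrite mulr1 scale1r -{1}(cat_take_drop n b) /rot.
by rewrite !blocks_cat; exact: same_charC.
Qed.

(** The bound on the number of blocks is used to estimate the
trace at small s. *)
Definition nonhyperbolic_or_positive b := `|\tr (blocks (1 : int) b)| <= 2 \/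
  exists (e : bool) j c, (size c <= size b)%N /\
    forall (A : comNzRingType) (s : A),
      same_char (blocks s b) (((-1) ^+ e * s ^+ j) *: pos_blocks s c).

Lemma nonhyperbolic_or_positive_reduces b b' : (size b' <= size b)%N ->
  reduces b b' -> nonhyperbolic_or_positive b' -> nonhyperbolic_or_positive b.
Proof.
move=> szb [e [j bb']] [ell|[e' [j' [c [szc b'c]]]]].
  left; have [-> _] := bb' int 1.
  by rewrite mxtraceZ expr1n mulr1 normrM normr_sign mul1r.
right; exists (e (+) e'), (j + j')%N, c; split=> [|A s].
  exact: leq_trans szc szb.
apply: same_char_trans (bb' _ _) _.
rewrite signr_addb exprD mulrACA -(scalerA ((-1) ^+ e * s ^+ j)).
by apply: same_charZ; exact: b'c.
Qed.

Lemma reduces_blow_down m n b : reduces [:: m.+1, 0%N, n.+1 & b] [:: m, n & b].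
Proof.
exists false, 1%N => A s; rewrite mul1r expr1 !blocks_cons !mulrA blow_down.
by rewrite -!scalerAl; exact: same_char_refl.
Qed.

Lemma reduces_blow_down2 m n b :
  reduces [:: m, 0%N, 0%N, n & b] ((m + n)%N :: b).
Proof.
exists true, 0%N => A s; rewrite mulr1 expr1 !blocks_cons !mulrA blow_down2.
by rewrite scaleN1r mulNr; exact: same_char_refl.
Qed.

Lemma reduces_pair n : reduces [:: 0%N; n.+2] [:: n].
Proof.
exists false, 1%N => A s; rewrite mul1r expr1 /blocks big_cons !big_seq1.
exact: blow_down_pair.
Qed.

(** The trace of this product of three blocks is -1 - s^n. *)
Lemma nonhyperbolic_00n n : nonhyperbolic_or_positive [:: 0%N; 0%N; n].
Proof.
left; rewrite /blocks !big_cons big_nil mulr1 mulrA block0_cube mxtrace_mx2.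
by rewrite expr1n.
Qed.

(** Each blow-down shortens the cyclic sequence.  The
process stops at a sequence without index 0, or at one so short that its trace
at s = 1 can be computed. *)
Lemma blocks_nonhyperbolic_or_positive b : nonhyperbolic_or_positive b.
Proof.
have [l] := ubnP (size b); elim: l b => // l IH b; rewrite ltnS => szb.
have [pos|] := boolP (all (leq 1) b).
  right; exists false, 0%N, (map predn b).
  split=> [|A s]; first by rewrite size_map.
  rewrite mulr1 scale1r; have {1}-> : b = map succn (map predn b).
    rewrite -map_comp -[LHS]map_id; apply/eq_in_map => n /(allP pos) /=.
    by case: n.
  exact: blocks_pos_conj.
rewrite -has_predC => /hasP[n nb]; rewrite /= -eqn0Ngt => /eqP n0.
rewrite {n}n0 in nb.
have [k c Erot] := rot_to nb.
have szc : (size c).+1 = size b by rewrite -(size_rot k b) Erot.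
apply: nonhyperbolic_or_positive_reduces (reduces_rot k b) _.
  by rewrite size_rot.
rewrite Erot {k nb Erot}.
(* Stated for any b0 of the size of b, so as to apply after rotations. *)
have step b0 b1 : size b0 = size b -> (size b1 < size b)%N ->
    reduces b0 b1 -> nonhyperbolic_or_positive b0.
  move=> sz0 lt10 red; apply: nonhyperbolic_or_positive_reduces red _.
    by rewrite sz0 ltnW.
  by apply: IH; lia.
case: c szc => [|n c] szc.
  by left; rewrite /blocks big_seq1 /block mxtrace_mx2 qintS qint0 mulr0 !addr0.
case: (lastP c) szc => [|{}c m] szc.
  case: n szc => [|[|n]] szc.
  - left; rewrite /blocks big_cons big_seq1 /block mx2M mxtrace_mx2.
    by rewrite !qintS qint0.
  - left; rewrite /blocks big_cons big_seq1 /block mx2M mxtrace_mx2.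
    by rewrite !qintS qint0.
  - by apply: step (reduces_pair n); rewrite -szc.
have rotm p d : reduces (p :: rcons d m) (m :: p :: d).
  have -> : [:: m, p & d] = rot (size d).+1 (p :: rcons d m).
    by rewrite -cats1; exact/esym/(rot_size_cat (p :: d)).
  exact: reduces_rot.
have szE := szc; rewrite /= size_rcons in szE.
apply: nonhyperbolic_or_positive_reduces (rotm 0%N (n :: c)) _.
  by rewrite /= size_rcons.
(* The index 0 now stands between its cyclic neighbours m and n.  If one of
   them is 0 too, the fourth index needed by reduces_blow_down2 exists unless
   the sequence is a rotation of 0, 0, n. *)
case: n szc => [|n] szc.
  case: c szc szE {rotm} => [|n' c] szc szE.
    have: reduces [:: m; 0%N; 0%N] [:: 0%N; 0%N; m] by exact: (reduces_rot 1).
    move/nonhyperbolic_or_positive_reduces; apply=> //.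
    exact: nonhyperbolic_00n.
  by apply: step (reduces_blow_down2 m n' c); rewrite /= -szE //= ltnS leqW.
case: m szc rotm => [|m] szc rotm; last first.
  by apply: step (reduces_blow_down m n c); rewrite /= -szE.
case: (lastP c) szE {szc rotm} => [|{}c m'] szE.
  exact: nonhyperbolic_00n.
rewrite size_rcons in szE.
have: reduces [:: 0, 0, n.+1 & rcons c m']%N [:: m', 0, 0, n.+1 & c]%N.
  have -> : [:: m', 0, 0, n.+1 & c]%N =
      rot (size c).+3 [:: 0, 0, n.+1 & rcons c m']%N.
    by rewrite -cats1; exact/esym/(rot_size_cat [:: 0, 0, n.+1 & c]%N).
  exact: reduces_rot.
move/nonhyperbolic_or_positive_reduces; apply; first by rewrite /= size_rcons.
by apply: step (reduces_blow_down2 m' n.+1 c); rewrite /= -szE //= ltnS leqW.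
Qed.

(** * Coefficients and degrees of the traces *)

Section NonnegCoef.
Variable R : realFieldType.
Implicit Types p q : {poly R}.

Definition nonneg_coef p := forall i, 0 <= p`_i.

Lemma nonneg_coef0 : nonneg_coef 0.
Proof. by move=> i; rewrite coef0. Qed.

Lemma nonneg_coef1 : nonneg_coef 1.
Proof. by move=> i; rewrite coef1 ler0n. Qed.

Lemma nonneg_coefXn n : nonneg_coef 'X^n.
Proof. by move=> i; rewrite coefXn ler0n. Qed.

Lemma nonneg_coefD p q : nonneg_coef p -> nonneg_coef q -> nonneg_coef (p + q).
Proof. by move=> p0 q0 i; rewrite coefD addr_ge0. Qed.

Lemma nonneg_coefM p q : nonneg_coef p -> nonneg_coef q -> nonneg_coef (p * q).
Proof.
by move=> p0 q0 i; rewrite coefM sumr_ge0 // => j _; rewrite mulr_ge0.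
Qed.

Lemma nonneg_coef_qintX n : nonneg_coef (qint 'X n).
Proof.
elim: n => [|n IH]; first by rewrite qint0; exact: nonneg_coef0.
rewrite qintSr; exact: nonneg_coefD IH (nonneg_coefXn n).
Qed.

Lemma nonneg_coef_pos_blocksX c k l : nonneg_coef (pos_blocks 'X c k l).
Proof.
rewrite /pos_blocks; elim: c k l => [|n c IH] k l.
  rewrite big_nil mxE; case: eqP => _; first exact: nonneg_coef1.
  exact: nonneg_coef0.
have pb i j : nonneg_coef (pos_block ('X : {poly R}) n i j).
  have Xq m : nonneg_coef ('X * qint ('X : {poly R}) m).
    exact: nonneg_coefM (nonneg_coefXn 1) (nonneg_coef_qintX m).
  rewrite mxE; do 2?case: ifP => _; try exact: Xq.
    exact: nonneg_coef1.
  exact: nonneg_coef1.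
by rewrite big_cons mulr_mxE; apply: nonneg_coefD; exact: nonneg_coefM.
Qed.

End NonnegCoef.

Lemma size_qintX (R : idomainType) n :
  (size (qint ('X : {poly R}) n) <= n)%N.
Proof.
elim: n => [|n IH]; first by rewrite qint0 size_poly0.
rewrite qintSr; apply: leq_trans (size_polyD _ _) _.
by rewrite geq_max size_polyXn leqnn leqW.
Qed.

Lemma size_blocksX (R : idomainType) b i j :
  (size (blocks ('X : {poly R}) b i j) <= (sumn b).+1)%N.
Proof.
elim: b i j => [|n b IH] i j.
  rewrite /blocks big_nil mxE.
  by case: (_ == _); rewrite ?size_poly0 ?size_poly1.
have szb k l : (size (block ('X : {poly R}) n k l) <= n.+1)%N.
  rewrite mxE; case: ifP; case: ifP => _ _; rewrite ?size_poly0 ?size_poly1 //.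
    exact: size_qintX.
  by rewrite size_polyN size_polyXn.
rewrite blocks_cons mxE; apply: leq_trans (size_sum _ _ _) _.
apply/bigmax_leqP => k _; apply: leq_trans (size_polyMleq _ _) _.
by move: (szb i k) (IH k j) => /=; lia.
Qed.

(** * Reciprocity and monotonicity *)

(** The Burau representation is unitary: replacing t by 1/t amounts to
passing to the inverse transpose, up to one change of basis for all words.  In
size two
the inverse transpose is conjugate to the matrix itself divided by the
determinant, and G combines both changes of basis. *)
Lemma burau_recip (R : realFieldType) (s : R) u : s != 0 ->
  s ^+ size u * \tr (burau_pos (- s^-1) u) = \tr (burau_pos (- s) u).
Proof.
move=> s0; pose G := mx2 s (1 - s) (s - 1) 1.
(* The determinant of G, positive for all real s. *)
pose d := 1 - s + s ^+ 2.
have d0 : d != 0 by rewrite /d; apply: lt0r_neq0; nra.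
pose G' := d^-1 *: mx2 1 (s - 1) (1 - s) s.
have GG' : G * G' = 1.
  rewrite -scalerAr mx2M mx2Z mx2_1; congr mx2; rewrite /d; field; exact: d0.
have conj : (s ^+ size u *: burau_pos (- s^-1) u) * G = G * burau_pos (- s) u.
  rewrite /burau_pos; elim: u => [|i u IH].
    by rewrite !big_nil scale1r mulr1 mul1r.
  rewrite !big_cons /= exprS -scalerA scalerAr -!scalerAl -mulrA IH mulrA.
  rewrite scalerAl mulrA; congr (_ * _).
  rewrite !burau_genE; case: ifP => _;
    rewrite !mx2M mx2Z; congr mx2; by [ring | field; exact: s0].
rewrite -[LHS]mxtraceZ -[_ *: _]mulr1 -GG' mulrA conj -mulrA.
have G'G : G' * G = 1.
  rewrite -scalerAl mx2M mx2Z mx2_1; congr mx2; rewrite /d; field; exact: d0.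
by rewrite [LHS]mxtrace_mulC -mulmxA [_ *m G]G'G mulmx1.
Qed.

Section Balanced.
Variables (R : realFieldType).

(** The difference of the two sides is
(r^i - s^i)(1 - (rs)^(n-i)) + (r^(n-i) - s^(n-i))(1 - (rs)^i). *)
Lemma balanced_pair_lt (s r : R) i n : 0 <= s -> s < r -> r <= 1 ->
  (0 < i < n)%N ->
  (s ^+ i + s ^+ (n - i)) * (1 + r ^+ n) <
  (r ^+ i + r ^+ (n - i)) * (1 + s ^+ n).
Proof.
move=> s0 sr r1 /andP[i0 iltn]; have r0 : 0 <= r by lra.
rewrite -{2 4}(subnKC (ltnW iltn)) !exprD.
have lt k : (0 < k)%N -> s ^+ k < r ^+ k by move=> k0; rewrite ltrXn2r // -lt0n.
have le1 k : r ^+ k <= 1 by exact: exprn_ile1.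
have ge0 k : 0 <= s ^+ k by exact: exprn_ge0.
have := lt _ i0; have := lt (n - i)%N; rewrite subn_gt0 => /(_ iltn).
move: (le1 i) (le1 (n - i)%N) (ge0 i) (ge0 (n - i)%N).
move: (s ^+ i) (r ^+ i) (s ^+ (n - i)) (r ^+ (n - i)) => a a' b b' *.
have aa' : 0 < 1 - a * a' by nra.
have bb' : 0 < 1 - b * b' by nra.
nra.
Qed.

Variables (q : {poly R}) (n : nat).
Hypothesis q_supp : forall i, q`_i != 0 -> (0 < i < n)%N.
Hypothesis q_recip : forall s, s != 0 -> s ^+ n * q.[s^-1] = q.[s].

(** Averaging q with its reciprocal image pairs the exponents i and
n - i, without any prior knowledge that the coefficients are symmetric. *)
Lemma balanced_double s :
  2 * q.[s] = \sum_(i < n | q`_i != 0) q`_i * (s ^+ i + s ^+ (n - i)).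
Proof.
have szq : (size q <= n)%N.
  apply/leq_sizeP => j nj; apply/eqP; apply: contraLR nj => /q_supp.
  by rewrite -ltnNge => /andP[].
rewrite big_rmcond; last by move=> i; rewrite negbK => /eqP->; rewrite mul0r.
have [->|s0] := eqVneq s 0.
  rewrite (horner_coef_wide _ szq) !big1 ?mulr0 // => i _.
    have [->|/q_supp/andP[i0 iltn]] := eqVneq q`_i 0; first by rewrite mul0r.
    by rewrite expr0n gtn_eqF // mulr0.
  have [->|/q_supp/andP[i0 iltn]] := eqVneq q`_i 0; first by rewrite mul0r.
  by rewrite !expr0n !gtn_eqF ?subn_gt0 //= addr0 mulr0.
rewrite mulr2n mulrDl mul1r -{2}(q_recip s0) !(horner_coef_wide _ szq).
rewrite mulr_sumr -big_split; apply: eq_bigr => i _ /=.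
rewrite mulrDr; congr (_ + _); rewrite mulrCA; congr (_ * _).
by rewrite exprVn -{1}(subnK (ltnW (ltn_ord i))) exprD mulfK // expf_neq0.
Qed.

Hypothesis q_ge0 : forall i, 0 <= q`_i.
Hypothesis q1_gt0 : 0 < q.[1].

Lemma balanced_increasing s r : 0 <= s -> s < r -> r <= 1 ->
  q.[s] * (1 + r ^+ n) < q.[r] * (1 + s ^+ n).
Proof.
move=> s0 sr r1; rewrite -(ltr_pM2l (ltr0n _ 2)) !mulrA !balanced_double.
rewrite !mulr_suml; apply: ltr_sum => [|i qi].
  apply: contraTT q1_gt0 => /hasPn q0.
  rewrite -leNgt -(ler_pM2l (ltr0n _ 2)) mulr0 balanced_double.
  rewrite big_seq_cond big1 // => i /andP[/q0 /negP qi0]; move=> /qi0 //.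
rewrite -!mulrA ltr_pM2l ?balanced_pair_lt ?q_supp //.
by rewrite lt0r qi q_ge0.
Qed.

End Balanced.

(** * The bound at the square of the inverse golden ratio *)

Section Bound.
Variables (R : realFieldType) (phi : R).

(** Nonnegative matrices that map the vector (phi, 1) below itself
entrywise. *)
Definition subinvariant (X : 'M[R]_2) :=
  [/\ forall i j, 0 <= X i j, X ord0 ord0 * phi + X ord0 ord_max <= phi
    & X ord_max ord0 * phi + X ord_max ord_max <= 1].

Lemma subinvariant1 : 0 < phi -> subinvariant 1.
Proof.
move=> phi_gt0; split=> [i j||]; first by rewrite mxE ler0n.
  by rewrite !mxE /=; nra.
by rewrite !mxE /=; nra.
Qed.

Lemma subinvariantM X Y :
  subinvariant X -> subinvariant Y -> subinvariant (X * Y).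
Proof.
move=> [X0 X1 X2] [Y0 Y1 Y2]; split=> [i j||]; rewrite !mulr_mxE.
- by rewrite addr_ge0 ?mulr_ge0.
- have := ler_wpM2l (X0 ord0 ord0) Y1; have := ler_wpM2l (X0 ord0 ord_max) Y2.
  move: X1; rewrite !mulrDr !mulrDl !mulrA !mulr1; lra.
- have := ler_wpM2l (X0 ord_max ord0) Y1.
  have := ler_wpM2l (X0 ord_max ord_max) Y2.
  move: X2; rewrite !mulrDr !mulrDl !mulrA !mulr1; lra.
Qed.

Lemma subinvariantZ k X : 0 < phi -> 0 <= k <= 1 ->
  subinvariant X -> subinvariant (k *: X).
Proof.
move=> phi_gt0 /andP[k0 k1] [X0 X1 X2]; split=> [i j||]; rewrite !mxE.
- by rewrite mulr_ge0.
- by rewrite -mulrA -mulrDr (le_trans (ler_wpM2l k0 X1)) // ler_piMl // ltW.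
- by rewrite -mulrA -mulrDr (le_trans (ler_wpM2l k0 X2)) // mulr1.
Qed.

(** The claim is that the characteristic polynomial is nonnegative at
1.  The two inequalities of subinvariance bound the off-diagonal entries by
the complements to 1 of the diagonal ones, and phi cancels in their
product. *)
Lemma subinvariant_trace X : 0 < phi -> subinvariant X -> \tr X <= 1 + \det X.
Proof.
move=> phi_gt0 [X0 X1 X2]; rewrite (mx2_eta X) mxtrace_mx2 det_mx2.
move: (X0 ord0 ord0) (X0 ord0 ord_max) X1 X2.
move: (X0 ord_max ord0) (X0 ord_max ord_max).
move: (X ord0 ord0) (X ord0 ord_max) (X ord_max ord0) (X ord_max ord_max).
move=> a b c d c0 d0 a0 b0 X1 X2.
have le1 : b <= (1 - a) * phi by lra.
have le2 : c * phi <= 1 - d by lra.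
have : b * (c * phi) <= (1 - a) * phi * (1 - d)
  by apply: ler_pM => //; rewrite mulr_ge0 // ltW.
have -> : b * (c * phi) = phi * (b * c) by ring.
have -> : (1 - a) * phi * (1 - d) = phi * ((1 - a) * (1 - d)) by ring.
rewrite ler_pM2l //; lra.
Qed.

Lemma phi_lt1 : 0 < phi -> phi ^+ 2 + phi = 1 -> phi < 1.
Proof. by move=> phi_gt0 phi_eq; have := exprn_gt0 2 phi_gt0; lra. Qed.

Lemma qint_phi n : 0 < phi -> phi ^+ 2 + phi = 1 ->
  phi * qint (phi ^+ 2) n <= 1.
Proof.
move=> phi_gt0 phi_eq; have := exprn_qint (phi ^+ 2) n.
have -> : 1 - phi ^+ 2 = phi :> R by lra.
have : 0 <= (phi ^+ 2) ^+ n by rewrite exprn_ge0 // exprn_ge0 // ltW.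
lra.
Qed.

(** When n grows, pos_block s n tends to a matrix with
eigenvector (s, 1 - s) for the eigenvalue 1 / (1 - s), and the finite n are
dominated by the limit.  The value s = phi^2 is the one for which 1 - s is the
square root of s; the eigenvector is then proportional to (phi, 1) and the
eigenvalue is 1 / phi. *)
Lemma subinvariant_pos_block n : 0 < phi -> phi ^+ 2 + phi = 1 ->
  subinvariant (phi *: pos_block (phi ^+ 2) n).
Proof.
move=> phi_gt0 phi_eq; have q0 k : 0 <= qint (phi ^+ 2) k.
  by apply: sumr_ge0 => i _; rewrite exprn_ge0 // exprn_ge0 // ltW.
rewrite /pos_block mx2Z.
have := qint_phi n phi_gt0 phi_eq; have := qint_phi n.+1 phi_gt0 phi_eq.
move: (q0 n) (q0 n.+1).
move: (qint _ n) (qint _ n.+1) => x y x0 y0 y1 x1.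
split=> [i j||]; rewrite !mxE /=.
- by case: ifP; case: ifP => _ _; rewrite !mulr_ge0 ?exprn_ge0 // ltW.
- have -> : phi * (phi ^+ 2 * y) * phi + phi * (phi ^+ 2 * x) =
      phi ^+ 3 * (phi * y) + phi ^+ 2 * (phi * x) by ring.
  have -> : phi ^+ 3 = phi * phi ^+ 2 by ring.
  have -> : phi ^+ 2 = 1 - phi by rewrite -phi_eq; ring.
  have := phi_lt1 phi_gt0 phi_eq => phi_lt1.
  apply: (@le_trans _ _ (phi * (1 - phi) * 1 + (1 - phi) * 1)).
    by apply: lerD; rewrite ler_wpM2l ?mulr_ge0 ?subr_ge0 // ltW.
  have -> : phi * (1 - phi) * 1 + (1 - phi) * 1 = 1 - phi ^+ 2 by ring.
  by rewrite -phi_eq addrAC subrr add0r.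
- by nra.
Qed.

Lemma subinvariant_pos_blocks c : 0 < phi -> phi ^+ 2 + phi = 1 ->
  subinvariant (phi ^+ size c *: pos_blocks (phi ^+ 2) c).
Proof.
move=> phi_gt0 phi_eq; rewrite /pos_blocks; elim: c => [|n c IH].
  by rewrite big_nil scale1r; exact: subinvariant1.
rewrite big_cons /= exprS -scalerA scalerAr scalerAl.
exact: subinvariantM (subinvariant_pos_block n _ _) IH.
Qed.

End Bound.

(** * The trace at negative parameters *)

(** Two expressions of the same trace are combined.  The 2 r original
blocks locate the exponents: the factor s^r and the degrees of the blocks put
them between r and n - r.  The blocks left after the blow-downs give the sign
of the coefficients and the final bound: there are at most 2 r of them, each
costs a factor 1 / phi at s = phi^2, and s^r = phi^(2 r) pays for all. *)
Lemma trace_burau_neg (R : realFieldType) (u : seq 'I_2) :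
  2 < `|\tr (burau_pos (-1 : int) u)| ->
  exists (e : bool) (q : {poly R}),
  [/\ forall s, \tr (burau_pos (- s) u) = (-1) ^+ e * q.[s],
      forall i, 0 <= q`_i, forall i, q`_i != 0 -> (0 < i < size u)%N
    & forall phi, 0 < phi -> phi ^+ 2 + phi = 1 ->
        q.[phi ^+ 2] <= 1 + (phi ^+ 2) ^+ size u].
Proof.
move=> tr2; case: (burau_pos_blocks u) => [|[r [b [r0 szb szu Eu]]]].
  by rewrite leNgt tr2.
case: (blocks_nonhyperbolic_or_positive b) => [|[e [j [c [szc Eb]]]]].
  have [trE _] := Eu int 1; rewrite trE mxtraceZ normrM normrX normrN1 in tr2.
  by rewrite expr1n mul1r in tr2; rewrite leNgt tr2.
pose e' := e (+) odd r.
have sim (A : comUnitRingType) (s : A) : same_char (burau_pos (- s) u)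
    ((-1) ^+ e' *: (s ^+ (r + j) *: pos_blocks s c)).
  apply: same_char_trans (Eu _ _) _; rewrite (exprNn s r) -(signr_odd _ r) /e'.
  rewrite addbC signr_addb exprD scalerA mulrACA.
  rewrite -(scalerA ((-1) ^+ odd r * s ^+ r)).
  by apply: same_charZ; exact: Eb.
pose q : {poly R} := 'X^(r + j) * \tr (pos_blocks 'X c).
have qE s : q.[s] = \tr (s ^+ (r + j) *: pos_blocks s c).
  rewrite mxtraceZ /q hornerM hornerXn; congr (_ * _).
  rewrite -[LHS]/(horner_eval s _) -trace_map_mx map_pos_blocks.
  by rewrite /= /horner_eval hornerX.
have qX : q = (-1) ^+ (e' (+) odd r) * (\tr (blocks 'X b) * 'X^r).
  have [trX _] := Eu _ ('X : {poly R}); have [trX' _] := sim _ ('X : {poly R}).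
  rewrite mxtraceZ mxtraceZ -/q trX mxtraceZ in trX'.
  rewrite -[LHS](signrMK e') -trX' (exprNn 'X r) signr_addb signr_odd; ring.
exists e', q; split.
- by move=> s; have [-> _] := sim _ s; rewrite mxtraceZ qE.
- apply: nonneg_coefM; first exact: nonneg_coefXn.
  rewrite /mxtrace !big_ord_recl big_ord0 addr0.
  by apply: nonneg_coefD; exact: nonneg_coef_pos_blocksX.
- have sztr : (size (\tr (blocks ('X : {poly R}) b)) <= (sumn b).+1)%N.
    apply: leq_trans (size_sum _ _ _) _; apply/bigmax_leqP => k _.
    exact: size_blocksX.
  move=> i; rewrite qX; set T := \tr _ in sztr *.
  have -> : ((-1) ^+ (e' (+) odd r) * (T * 'X^r))`_i =
      (-1) ^+ (e' (+) odd r) * (T * 'X^r)`_i.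
    by case: (_ (+) _); rewrite ?expr1 ?expr0 ?mulN1r ?mul1r ?coefN.
  rewrite mulf_eq0 signr_eq0 /= coefMXn.
  case: ltnP => ri; first by rewrite eqxx.
  move=> Ti; have : (i - r < sumn b + 1)%N.
    rewrite addn1; apply: contraR Ti; rewrite -leqNgt => le.
    by rewrite nth_default // (leq_trans sztr).
  by lia.
- move=> phi phi0 phiE; rewrite qE.
  have [_ detE] := sim R (phi ^+ 2).
  rewrite detZ det_burau_pos opprK sqrr_sign mul1r in detE.
  rewrite detE; apply: (subinvariant_trace phi0).
  have -> : (phi ^+ 2) ^+ (r + j) =
      phi ^+ (2 * (r + j) - size c) * phi ^+ size c.
    by rewrite -exprM -exprD subnK //; lia.
  rewrite -scalerA; apply: subinvariantZ => //.
    by rewrite exprn_ge0 ?exprn_ile1 ?ltW // (phi_lt1 phi0 phiE).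
  exact: subinvariant_pos_blocks.
Qed.

(** * The spectral radius of a two-by-two real matrix *)

Lemma eigenvalue2E (F : fieldType) (M : 'M[F]_2) a :
  eigenvalue M a = (a ^+ 2 - \tr M * a + \det M == 0).
Proof.
rewrite /eigenvalue kermx_eq0 row_free_unit unitmxE unitfE negbK.
have -> : M - a%:M = mx2 (M ord0 ord0 - a) (M ord0 ord_max)
                         (M ord_max ord0) (M ord_max ord_max - a).
  by rewrite [LHS]mx2_eta !mxE /= ?mulr1n ?mulr0n ?subr0.
rewrite [in RHS](mx2_eta M) mxtrace_mx2 !det_mx2; congr (_ == 0); ring.
Qed.

Section Spectral.
Variable R : realType.
Implicit Types (p d : R).

Lemma spectral_radius_pair (M : 'M[R[i]]_2) (a b : R[i]) :
  \tr M = a + b -> \det M = a * b ->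
  spectral_radius M = Num.max (complex.Re `|a|) (complex.Re `|b|).
Proof.
move=> trM detM; rewrite /spectral_radius.
have eigE c : eigenvalue M c = (c == a) || (c == b).
  rewrite eigenvalue2E trM detM.
  have -> : c ^+ 2 - (a + b) * c + a * b = (c - a) * (c - b) by ring.
  by rewrite mulf_eq0 !subr_eq0.
set E := [set _ | _ in _]; set m := Num.max _ _.
have Eub : ubound E m.
  move=> _ [c /= + <-]; rewrite eigE le_max => /orP[]/eqP->.
    by rewrite lexx.
  by rewrite lexx orbT.
have Em : E m.
  rewrite /m; case: leP => _.
    by exists b => //=; rewrite eigE eqxx orbT.
  by exists a => //=; rewrite eigE eqxx.
apply/eqP; rewrite eq_le ge_sup ?ub_le_sup //.
  by exists m.
by exists m.
Qed.

Lemma Re_norm_real (x : R) : complex.Re `|x%:C| = `|x|.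
Proof. by rewrite normc_def /= expr0n addr0 sqrtr_sqr. Qed.

(** Conjugate eigenvalues have modulus sqrt d.  Real ones give the
spectral radius (|p| + sqrt (p^2 - 4 d)) / 2. *)
Lemma spectral_radius_eq1 (M : 'M[R]_2) : 0 <= \det M <= 1 ->
  spectral_radius (map_mx (real_complex R) M) = 1 <->
  `|\tr M| = 1 + \det M \/ \det M = 1 /\ `|\tr M| <= 2.
Proof.
have : \tr (map_mx (real_complex R) M) = (\tr M)%:C by rewrite trace_map_mx.
have : \det (map_mx (real_complex R) M) = (\det M)%:C by rewrite det_map_mx.
move: (map_mx _ M) => MC; move: (\tr M) (\det M) => p d detMC trMC /andP[d0 d1].
have sqp : `|p| ^+ 2 = p ^+ 2 by rewrite real_normK // num_real.
have p0 := normr_ge0 p.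
have [disc|disc] := ltP (p ^+ 2) (4 * d).
  pose r := Num.sqrt (4 * d - p ^+ 2) / 2.
  have r2 : r ^+ 2 = d - p ^+ 2 / 4.
    by rewrite expr_div_n sqr_sqrtr ?subr_ge0 ?ltW //; field.
  have sq : (p / 2) ^+ 2 + r ^+ 2 = d by rewrite r2; field.
  rewrite (@spectral_radius_pair MC (p / 2 +i* r) (p / 2 -i* r)).
  - rewrite !normc_def /= sqrrN sq maxxx; split=> [e|[e|[-> _]]].
    + right; have d1' : d = 1 by rewrite -(sqr_sqrtr d0) e expr1n.
      by split=> //; move: disc; rewrite -sqp d1'; nra.
    + by move: disc; rewrite -sqp e; nra.
    + exact: sqrtr1.
  - rewrite trMC; apply/eqP; rewrite eq_complex /= subrr eqxx andbT.
    by apply/eqP; field.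
  - rewrite detMC; apply/eqP; rewrite eq_complex /=; apply/andP.
    by split; apply/eqP; [rewrite -sq; ring | ring].
have [r r0 r2] : exists2 r : R, 0 <= r & r ^+ 2 = p ^+ 2 - 4 * d.
  exists (Num.sqrt (p ^+ 2 - 4 * d)); first exact: sqrtr_ge0.
  by rewrite sqr_sqrtr ?subr_ge0.
rewrite (@spectral_radius_pair MC ((p + r) / 2)%:C ((p - r) / 2)%:C);
  first last.
- rewrite detMC -rmorphM; congr (_%:C).
  have -> : d = (p ^+ 2 - r ^+ 2) / 4 by rewrite r2; field.
  by field.
- by rewrite trMC -rmorphD; congr (_%:C); field.
rewrite !Re_norm_real.
have -> : Num.max `|(p + r) / 2| `|(p - r) / 2| = (`|p| + r) / 2.
  have [pge|plt] := leP 0 p.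
    rewrite (ger0_norm pge) (@ger0_norm _ ((p + r) / 2)); last by lra.
    by rewrite max_l // ler_norml; apply/andP; split; lra.
  rewrite (ltr0_norm plt) (@ler0_norm _ ((p - r) / 2)); last by lra.
  rewrite max_r; first by lra.
  by rewrite ler_norml; apply/andP; split; lra.
move: sqp p0; move: `|p| => P sqp p0.
rewrite -sqp in r2 disc; split=> [e|[e|[e1 e2]]].
- left; have er : r = 2 - P by lra.
  by rewrite er in r2; nra.
- have : (r - (1 - d)) * (r + (1 - d)) = 0 by rewrite e in r2; nra.
  by move=> /eqP; rewrite mulf_eq0 => /orP[]/eqP; nra.
- have : r ^+ 2 = 0 by nra.
  by move=> /eqP; rewrite expf_eq0 => /eqP ->; nra.
Qed.

End Spectral.

(** * Contraction at positive parameters *)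

Section Contraction.
Variable R : realFieldType.
Implicit Types (t : R) (v : 'rV[R]_2).

(** The inner product, on row vectors, for which the eigenlines of each
generator for the eigenvalues 1 and -t are orthogonal. *)
Definition qform t v : R :=
  (1 + t) * v 0 ord0 ^+ 2 + 2 * t * (v 0 ord0 * v 0 ord_max)
    + t * (1 + t) * v 0 ord_max ^+ 2.

Lemma qform_gt0 t v : 0 < t -> v != 0 -> 0 < qform t v.
Proof.
move=> t0; apply: contra_neqT; rewrite -leNgt /qform => le0.
suff [e0 e1] : v 0 ord0 = 0 /\ v 0 ord_max = 0.
  apply/rowP => j; rewrite mxE; case: j => [[|[|//]] ?].
    by rewrite -[RHS]e0; congr (v _ _); apply: val_inj.
  by rewrite -[RHS]e1; congr (v _ _); apply: val_inj.
move: (v 0 ord0) (v 0 ord_max) le0 => x y.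
have -> : (1 + t) * x ^+ 2 + 2 * t * (x * y) + t * (1 + t) * y ^+ 2 =
  x ^+ 2 + t * (x + y) ^+ 2 + t ^+ 2 * y ^+ 2 by ring.
have x2 := sqr_ge0 x.
have xy2 : 0 <= t * (x + y) ^+ 2 by rewrite mulr_ge0 ?sqr_ge0 // ltW.
have y2 : 0 <= t ^+ 2 * y ^+ 2 by rewrite mulr_ge0 ?sqr_ge0.
move=> le0; split; apply/eqP; rewrite -sqrf_eq0; apply/eqP; first by lra.
have /eqP : t ^+ 2 * y ^+ 2 = 0 by lra.
by rewrite mulf_eq0 expf_eq0 /= gt_eqF // => /eqP.
Qed.

Lemma row_mulE v (M : 'M[R]_2) j :
  (v *m M) 0 j = v 0 ord0 * M ord0 j + v 0 ord_max * M ord_max j.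
Proof.
rewrite mxE !big_ord_recl big_ord0 addr0; congr (_ + v _ _ * M _ _);
  exact: val_inj.
Qed.

(** A generator fixes the line v 0 i = 0 and multiplies the orthogonal
line by -t, so what is lost is a multiple of the square of v 0 i. *)
Lemma qform_burau_gen t v i : qform t (v *m burau_gen t i) =
  qform t v - (1 - t ^+ 3) * (if i == ord0 then 1 else t) * v 0 i ^+ 2.
Proof.
rewrite /qform burau_genE !row_mulE; case: (eqVneq i ord0) => [->|i0].
  by rewrite !mxE /=; ring.
have -> : i = ord_max by case: i i0 => [[|[|//]] ?] // _; apply: val_inj.
by rewrite !mxE /=; ring.
Qed.

Lemma qform_burau_gen_le t v i : 0 < t <= 1 ->
  qform t (v *m burau_gen t i) <= qform t v.
Proof.
move=> /andP[t0 t1]; rewrite qform_burau_gen gerBl.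
apply: mulr_ge0 (sqr_ge0 _); apply: mulr_ge0.
  by rewrite subr_ge0 exprn_ile1 // ltW.
by case: (i == ord0); rewrite ?ler01 // ltW.
Qed.

Lemma burau_gen_fix t v i : v 0 i = 0 -> v *m burau_gen t i = v.
Proof.
move=> vi; apply/rowP => j; rewrite row_mulE burau_genE.
case: (eqVneq i ord0) vi => [->|i0] vi.
  rewrite vi !mxE /= mul0r add0r; case: j => [[|[|//]] ?] /=.
    by rewrite mulr0 -[LHS]vi; congr (v _ _); apply: val_inj.
  by rewrite mulr1; congr (v _ _); apply: val_inj.
have ei : i = ord_max by case: i i0 {vi} => [[|[|//]] ?] // _; apply: val_inj.
rewrite ei in vi; rewrite vi !mxE /= mul0r addr0; case: j => [[|[|//]] ?] /=.
  by rewrite mulr1; congr (v _ _); apply: val_inj.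
by rewrite mulr0 -[LHS]vi; congr (v _ _); apply: val_inj.
Qed.

Lemma qform_burau_le t v u : 0 < t <= 1 ->
  qform t (v *m burau_pos t u) <= qform t v.
Proof.
move=> t01; rewrite /burau_pos; elim: u v => [|i u IH] v.
  by rewrite big_nil mulmx1.
rewrite big_cons mulmxA; apply: le_trans (IH _) _.
exact: qform_burau_gen_le.
Qed.

(** Nothing can be lost at any letter, so each letter in turn fixes v,
and the next one acts on the same v. *)
Lemma qform_burau_eq t v u : 0 < t < 1 ->
  qform t v <= qform t (v *m burau_pos t u) -> forall i, i \in u -> v 0 i = 0.
Proof.
move=> /andP[t0 t1]; have t01 : 0 < t <= 1 by rewrite t0 ltW.
elim: u => // j u IH; rewrite /burau_pos big_cons mulmxA => le_v i.
have vj : v 0 j = 0.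
  have := le_trans le_v (qform_burau_le _ u t01); rewrite qform_burau_gen.
  have k0 : 0 < (1 - t ^+ 3) * (if j == ord0 then 1 else t).
    by rewrite mulr_gt0 ?subr_gt0 ?exprn_ilt1 ?(ltW t0) //; case: ifP.
  rewrite -subr_ge0 [X in X - _]addrC addrK oppr_ge0 pmulr_rle0 // => vj_le.
  by apply/eqP; rewrite -sqrf_eq0 eq_le vj_le sqr_ge0.
rewrite burau_gen_fix // in le_v.
by rewrite in_cons => /orP[/eqP->|/(IH le_v)].
Qed.

End Contraction.

Section PositiveParameter.
Variable R : realFieldType.
Implicit Types (t l : R) (v : 'rV[R]_2) (u : seq 'I_2).

Lemma qformZ t l v : qform t (l *: v) = l ^+ 2 * qform t v.
Proof. by rewrite /qform !mxE; ring. Qed.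

Lemma eigenvalue_burau_le1 t l u : 0 < t <= 1 ->
  eigenvalue (burau_pos t u) l -> l ^+ 2 <= 1.
Proof.
move=> t01 /eigenvalueP[v vW v0]; have [t0 _] := andP t01.
have := qform_burau_le v u t01; rewrite vW qformZ.
by rewrite ger_pMl // qform_gt0.
Qed.

Lemma eigenvalue_burau_lt1 t l u : 0 < t < 1 -> (forall i, i \in u) ->
  eigenvalue (burau_pos t u) l -> l ^+ 2 < 1.
Proof.
move=> t01 full /eigenvalueP[v vW v0]; have [t0 _] := andP t01.
rewrite ltNge; apply: contraNN v0 => l1.
have := @qform_burau_eq _ t v u t01; rewrite vW qformZ => vfix.
have q0 : 0 <= qform t v.
  by have [->|/(qform_gt0 t0)/ltW//] := eqVneq v 0; rewrite /qform !mxE; nra.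
apply/eqP/rowP => i; rewrite mxE; apply: vfix => //; exact: ler_peMl.
Qed.

(** Otherwise the sign of the trace would be an eigenvalue. *)
Lemma trace_burau_ne t u : 0 < t < 1 -> (forall i, i \in u) ->
  `|\tr (burau_pos t u)| <> 1 + \det (burau_pos t u).
Proof.
move=> t01 full trE; suff [l lE l2] : exists2 l,
    eigenvalue (burau_pos t u) l & l ^+ 2 = 1.
  by have := eigenvalue_burau_lt1 t01 full lE; rewrite l2 ltxx.
move: (burau_pos t u) trE => W; set p := \tr W => trE.
exists ((-1) ^+ (p < 0)%R); last exact: sqrr_sign.
have psg : p * (-1) ^+ (p < 0)%R = `|p|.
  by rewrite {1}[p](@realEsign _ p) ?num_real // mulrAC -expr2 sqrr_sign mul1r.
by rewrite eigenvalue2E psg trE sqrr_sign; apply/eqP; ring.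
Qed.

End PositiveParameter.

(** If the trace p were larger, both eigenvalues would be real, with
squares of sum p^2 - 2 > 2, while neither square exceeds 1. *)
Lemma trace_burau_1 (R : rcfType) (u : seq 'I_2) :
  \det (burau_pos (1 : R) u) = 1 -> `|\tr (burau_pos (1 : R) u)| <= 2.
Proof.
move=> det1; rewrite leNgt; apply/negP => tr2.
set p := \tr _ in tr2; have p2 : 4 < p ^+ 2.
  rewrite -[p ^+ 2]real_normK ?num_real // (_ : 4 = 2 ^+ 2 :> R); last by ring.
  by rewrite ltrXn2r.
have [r r2] : exists r : R, r ^+ 2 = p ^+ 2 - 4.
  by exists (Num.sqrt (p ^+ 2 - 4)); rewrite sqr_sqrtr // subr_ge0 ltW.
have t01 : 0 < (1 : R) <= 1 by rewrite ltr01 lexx.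
have ev l : l ^+ 2 - p * l + 1 = 0 -> l ^+ 2 <= 1.
  move=> lE; apply: (eigenvalue_burau_le1 (u := u) t01).
  by rewrite eigenvalue2E det1 -/p lE.
have l1 : ((p + r) / 2) ^+ 2 <= 1.
  apply: ev; have -> : ((p + r) / 2) ^+ 2 - p * ((p + r) / 2) + 1 =
    (r ^+ 2 - (p ^+ 2 - 4)) / 4 by field.
  by rewrite r2 subrr mul0r.
have l2 : ((p - r) / 2) ^+ 2 <= 1.
  apply: ev; have -> : ((p - r) / 2) ^+ 2 - p * ((p - r) / 2) + 1 =
    (r ^+ 2 - (p ^+ 2 - 4)) / 4 by field.
  by rewrite r2 subrr mul0r.
have : ((p + r) / 2) ^+ 2 + ((p - r) / 2) ^+ 2 = (p ^+ 2 + r ^+ 2) / 2 by field.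
rewrite r2; lra.
Qed.

(** * Data attached to a positive word *)

Lemma prod_sigma (u : seq 'I_2) :
  (\prod_(i <- u) sigma i)%g = \pi_Br3%qT [seq (i, false) | i <- u].
Proof.
elim: u => [|i u IH]; first by rewrite big_nil.
by rewrite big_cons IH [LHS]Br3_mul_pi.
Qed.

Lemma burau_prod_sigma (A : comUnitRingType) (t : A) (u : seq 'I_2) :
  t \is a GRing.unit -> burau t (\prod_(i <- u) sigma i)%g = burau_pos t u.
Proof.
move=> tU; rewrite prod_sigma burau_pi // /burau_word /burau_pos big_map.
by apply: eq_bigr => i _.
Qed.

Lemma burau_poly_prod_sigma (u : seq 'I_2) :
  burau_poly (\prod_(i <- u) sigma i)%g = burau_pos 'X u.
Proof.
have /matrixP e :
    map_mx (@tofrac {poly int}) (burau_poly (\prod_(i <- u) sigma i)%g) =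
    map_mx (@tofrac {poly int}) (burau_pos 'X u).
  rewrite burau_polyE; last by exists u.
  rewrite map_burau_pos /burau_generic burau_prod_sigma //.
  by rewrite unitfE tofrac_eq0 polyX_eq0.
apply/matrixP => i j; apply/eqP; rewrite -tofrac_eq.
by have := e i j; rewrite mxE [in RHS]mxE => ->.
Qed.

Lemma rho_real (R : realType) (u : seq 'I_2) (x : R) :
  rho (\prod_(i <- u) sigma i)%g x%:C =
  spectral_radius (map_mx (real_complex R) (burau_pos x u)).
Proof.
rewrite /rho burau_poly_prod_sigma map_burau_pos /=; congr spectral_radius.
have XE : (horner_eval x%:C \o map_poly intr) ('X : {poly int}) = x%:C.
  by rewrite /= /horner_eval map_polyX hornerX.
by rewrite -[in RHS]XE -map_burau_pos; apply: eq_map_mx.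
Qed.

Lemma pseudo_anosov_prod_sigma (u : seq 'I_2) :
  pseudo_anosov (\prod_(i <- u) sigma i)%g ->
  2 < `|\tr (burau_pos (-1 : int) u)|.
Proof. by rewrite /pseudo_anosov burau_prod_sigma. Qed.

Lemma transitive_perm_even (s : 'S_3) :
  (forall i j, fconnect s i j) -> ~~ odd_perm s.
Proof.
move=> trans; have porb i : porbit s i = [set: 'I_3]%SET.
  apply/setP => j; rewrite inE -(iter_findex (trans i j)) -permX.
  exact: mem_porbit.
rewrite /odd_perm card_ord; suff -> : porbits s = [set [set: 'I_3]%SET]%SET.
  by rewrite cards1.
apply/setP => B; rewrite inE; apply/imsetP/eqP => [[i _ ->//]|->].
by exists ord0.
Qed.

(** Each letter contributes a transposition, and a permutation of three
points with a single orbit is a 3-cycle. *)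
Lemma knot_even (u : seq 'I_2) :
  closure_is_knot (\prod_(i <- u) sigma i)%g -> ~~ odd (size u).
Proof.
rewrite prod_sigma => /closure_is_knot_pi /closure_is_knot_wordE.
move=> /transitive_perm_even; apply: contraNN => size_odd.
suff -> : odd_perm (word_perm [seq (i, false) | i <- u]) = odd (size u) by [].
elim: u {size_odd} => [|i u IH]; first by rewrite /word_perm big_nil odd_perm1.
rewrite /word_perm big_cons odd_permM -/(word_perm _) IH odd_tperm.
by rewrite -val_eqE /= !inordK //; case: i => [[|[|]] ?].
Qed.

(** A power of one generator is unipotent at t = -1. *)
Lemma hyperbolic_full (u : seq 'I_2) i :
  2 < `|\tr (burau_pos (-1 : int) u)| -> i \in u.
Proof.
apply: contraTT => iu; rewrite -leNgt.
suff -> : \tr (burau_pos (-1 : int) u) = 2 by [].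
suff [a [b [-> ab]]] : exists a b : int,
    burau_pos (-1) u = mx2 1 a b 1 /\ (if i == ord0 then a else b) = 0.
  by rewrite mxtrace_mx2.
rewrite /burau_pos; elim: u iu => [|j u IH].
  by move=> _; exists 0, 0; rewrite big_nil mx2_1; case: ifP.
rewrite in_cons negb_or => /andP[ij /IH[a [b [uE ab]]]].
rewrite big_cons uE burau_genE.
case: (eqVneq i ord0) ij ab => [-> j0 ->|i0 ij ->].
  rewrite eq_sym (negPf j0); exists 0, (b - 1); rewrite mx2M; split=> //.
  by congr mx2; ring.
have -> : j = ord0.
  by apply/val_inj; case: i j i0 ij {IH uE} => [[|[|//]] ?] [[|[|//]] ?].
by rewrite eqxx; exists (a + 1), 0; rewrite mx2M; split=> //; congr mx2; ring.
Qed.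

(** * The theorem *)

Theorem theorem1p2 (R : realType) (w : Br3) :
  positive w -> closure_is_knot w -> pseudo_anosov w ->
  exists x : R, -1 < x <= (Num.sqrt 5 - 3) / 2 /\
    Rset R w `&` real_axis R = [set 1; x%:C].
Proof.
move=> [u ->] /knot_even n_even /pseudo_anosov_prod_sigma tr2.
have full i : i \in u := hyperbolic_full i tr2.
have n0 : (0 < size u)%N by have := full ord0; case: (u).
have [e [q [trE q0 q_supp q_bound]]] := trace_burau_neg R tr2.
set n := size u in n_even n0 q_supp q_bound *.
have q_ge0 s : 0 <= s -> 0 <= q.[s].
  move=> s0; rewrite horner_coef sumr_ge0 // => i _.
  by rewrite mulr_ge0 ?exprn_ge0.
have normE s : 0 <= s -> `|\tr (burau_pos (- s) u)| = q.[s].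
  by move=> s0; rewrite trE normrM normr_sign mul1r ger0_norm ?q_ge0.
have q1 : 2 < q.[1].
  rewrite -normE //; have -> : (-1 : R) = (-1)%:~R by [].
  by rewrite -map_burau_pos trace_map_mx -intr_norm (ltr_int R 2).
have q_recip s : s != 0 -> s ^+ n * q.[s^-1] = q.[s].
  move=> s0; have := burau_recip u s0; rewrite !trE mulrCA.
  by move/(mulfI _); apply; rewrite signr_eq0.
have q1_gt0 : 0 < q.[1] by lra.
have incr := balanced_increasing q_supp q_recip q0 q1_gt0.
pose phi : R := (Num.sqrt 5 - 1) / 2.
have sqrt5 : Num.sqrt 5 ^+ 2 = 5 :> R by rewrite sqr_sqrtr.
have sqrt5_gt1 : 1 < Num.sqrt 5 :> R.
  by rewrite -[X in X < _]sqrtr1 ltr_sqrt // ltr1n.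
have phi0 : 0 < phi by rewrite /phi; lra.
have phi2 : phi ^+ 2 = (3 - Num.sqrt 5) / 2.
  have -> : phi ^+ 2 = (Num.sqrt 5 ^+ 2 - 2 * Num.sqrt 5 + 1) / 4.
    by rewrite /phi; field.
  by rewrite sqrt5; field.
have phiE : phi ^+ 2 + phi = 1 by rewrite phi2 /phi; field.
have phi2_lt1 : phi ^+ 2 < 1 by rewrite -phiE ltrDl.
(* The value at phi ^+ 2 is nonpositive by q_bound, the value at 1 positive by
   the pseudo-Anosov hypothesis. *)
pose h : {poly R} := q - (1 + 'X^n).
have hE s : h.[s] = q.[s] - (1 + s ^+ n) by rewrite /h !hornerE.
have [||x /andP[phix x1] /rootP] := @poly_ivt _ h (phi ^+ 2) 1.
- exact: ltW.
- rewrite !hE subr_le0 q_bound // expr1n; lra.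
rewrite hE => /eqP; rewrite subr_eq0 => /eqP qx.
have x_lt1 : x < 1.
  rewrite lt_neqAle x1 andbT; apply/eqP => x1'.
  by move: qx; rewrite x1' expr1n; lra.
have x0 : 0 <= x by apply: le_trans phix; rewrite exprn_ge0 // ltW.
have x_uniq s : 0 <= s <= 1 -> q.[s] = 1 + s ^+ n -> s = x.
  move=> /andP[s0 s1] qs; apply/eqP; case: (ltgtP s x) => // sx.
    by have := incr _ _ s0 sx x1; rewrite qs qx mulrC ltxx.
  by have := incr _ _ x0 sx s1; rewrite qs qx mulrC ltxx.
have detE (t : R) : \det (burau_pos t u) = t ^+ n :> R.
  by rewrite det_burau_pos exprNn -signr_odd (negPf n_even) mul1r.
have det01 (t : R) : -1 <= t <= 1 -> 0 <= \det (burau_pos t u) <= 1.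
  move=> t01; have t1 : `|t| <= 1 by rewrite ler_norml.
  have -> : \det (burau_pos t u) = `|t| ^+ n.
    by rewrite detE -normrX ger0_norm // exprn_even_ge0.
  by rewrite exprn_ge0 ?normr_ge0 // exprn_ile1.
exists (- x); split; first by apply/andP; split; rewrite phi2 in phix; lra.
have discE (t : R) : closed_disc t%:C <-> -1 <= t <= 1.
  by rewrite /closed_disc /= normc_def /= expr0n addr0 sqrtr_sqr lecR ler_norml.
apply/seteqP; split=> [[t b] [[tdisc +] b0]|z].
  have {}b0 : b = 0 := b0; rewrite {}b0 in tdisc *; rewrite -/(t%:C) in tdisc *.
  move/discE in tdisc; have [tge tle] := andP tdisc.
  rewrite rho_real => /(spectral_radius_eq1 (det01 t tdisc)) trho.
  have [t0|t0] := leP t 0.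
    (* The alternative det = 1 only occurs at t = -1, where |tr| > 2. *)
    right; congr (_%:C); rewrite -(x_uniq (- t)) ?opprK //.
      by apply/andP; lra.
    have nt0 : 0 <= - t by rewrite oppr_ge0.
    have ntn : (- t) ^+ n = t ^+ n.
      by rewrite exprNn -signr_odd (negPf n_even) mul1r.
    have := normE _ nt0; rewrite opprK => trE'; rewrite trE' detE in trho.
    rewrite ntn; case: trho => // -[tn1].
    move/eqP: tn1; rewrite -ntn pexpr_eq1 // => /eqP ->; rewrite expr1n; lra.
  left; case: (ltrP t 1) => [t1|t1]; last by congr (_%:C); lra.
  have t01 : 0 < t < 1 by rewrite t0.
  case: trho => [/(trace_burau_ne t01 full) //|[/eqP + _]].
  by rewrite detE pexpr_eq1 ?(ltW t0) // => /eqP t1'; rewrite t1' ltxx in t1.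
have in_R (t : R) : -1 <= t <= 1 ->
    `|\tr (burau_pos t u)| = 1 + \det (burau_pos t u) \/
    \det (burau_pos t u) = 1 /\ `|\tr (burau_pos t u)| <= 2 ->
    (Rset R (\prod_(i <- u) sigma i)%g `&` real_axis R) t%:C.
  move=> t1 trdet; split=> //; split; first exact/discE.
  by rewrite rho_real; apply/(spectral_radius_eq1 (det01 t t1)).
case=> ->.
  apply: (in_R 1); first by apply/andP; lra.
  right; rewrite detE expr1n; split=> //.
  by apply: trace_burau_1; rewrite detE expr1n.
apply: in_R; first by apply/andP; lra.
left; rewrite normE // detE qx.
by rewrite exprNn -signr_odd (negPf n_even) mul1r.
Qed.
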